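(* There exist an absolute constant $C>0$ and a function $f$ on pairs of positive integers with $f(d,\Delta)\le 2^{(Cd\Delta)^d}$ such that the following holds. Let $d,\Delta,n$ be positive integers and let $T_1,\dots,T_n$ be finite multisets of vectors in $\mathbb{Z}^d$, each vector of $\ell_\infty$-norm at most $\Delta$. Suppose there are $b\in\mathbb{Z}^d$ and a positive integer $\epsilon$ such that $\big\|\sum_{v\in T_i} v - b\big\|_\infty<\epsilon$ for all $i\in\{1,\dots,n\}$. If $\|b\|_\infty>\epsilon\cdot f(d,\Delta)$, then there exist nonempty submultisets $S_i\subseteq T_i$ for all $i\in\{1,\dots,n\}$ and a vector $b'\in\mathbb{Z}^d$ with $\|b'\|_\infty\le f(d,\Delta)$ such that $\sum_{v\in S_i}v=b'$ for all $i\in\{1,\dots,n\}$. *)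

(* Defs.v *)
From mathcomp Require Export all_boot all_order all_algebra.
From mathcomp Require Export finmap multiset.
From mathcomp Require Export reals normedtype exp.

Set Implicit Arguments.
Unset Strict Implicit.
Unset Printing Implicit Defensive.

(* For v : 'rV[int]_d, `|v| : int is normedtype's matrix norm mx_norm, i.e. the
   maximum of the absolute values of the entries: the l_infinity norm. *)

(* Main.v *)
Require Import Defs.
From mathcomp Require Import perm ring zify boolp.
Import Order.TTheory GRing.Theory Num.Theory.

Set Implicit Arguments.
Unset Strict Implicit.
Unset Printing Implicit Defensive.

(** Put [X = (d Delta)^d] and let [L] be a common multiple of [1, ..., X], which
    can be chosen with [L <= 2^(4X)].  Drop from each [T_i] the vectors of small
    multiplicity; this moves the sum by a bounded amount, so [b] is close to the
    cone spanned by the remaining vectors [U_i].  A quantitative Farkas lemma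
    cuts each of these cones out by integral normals of norm at most [2X],
    whatever [n] is.  Applying the lemma again to all normals involved, either
    a unit vector [- sgn (b_j) e_j] is a nonnegative combination of the normals
    with small coefficients, which bounds [b_j], or there is a short nonzero
    integral [r] in all the cones.  By Caratheodory's theorem and Cramer's rule,
    [q r] is a nonnegative integral combination of [U_i] for some [q <= X],
    hence so is [b' = L r], and the coefficients do not exceed the multiplicities. *)

(** * Farkas' lemma and Caratheodory's theorem over an ordered field *)

Local Open Scope ring_scope.

(** Induction on the rows. If the separator [x0] of [b] from the later rows [A'] fails on the first
    row [a], everything is projected along [a] onto the hyperplane orthogonal to [x0]; this sends
    [a] to zero. *)
Lemma farkas (F : realFieldType) (d m : nat) (A : 'M[F]_(m, d)) (b : 'rV[F]_d) :
  (exists2 y : 'rV[F]_m, (forall i, 0 <= y 0 i) & y *m A = b) \/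
  (exists2 r : 'cV[F]_d, (forall i, 0 <= (A *m r) i 0) & (b *m r) 0 0 < 0).
Proof.
elim: m A b => [|m IHm] A b.
  have [->|/rV0Pn[j bj]] := eqVneq b 0.
    by left; exists 0 => [[]|]; rewrite ?mul0mx.
  right; exists (\col_k (- b 0 k)) => [[] //|].
  rewrite mxE; under eq_bigr => k _ do rewrite mxE mulrN -expr2.
  rewrite sumrN oppr_lt0 (bigD1 j) //= ltr_pwDl ?exprn_even_gt0 //.
  by apply: sumr_ge0 => k _; rewrite sqr_ge0.
move: A; rewrite -[m.+1]/(1 + m)%N => A.
pose a := usubmx A; pose A' := dsubmx A.
have defA : A = col_mx a A' by rewrite vsubmxK.
case: (IHm A' b) => [[y y0 yb]|[x0 Ax0 bx0]].
  left; exists (row_mx 0 y : 'rV_(1 + m)); last first.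
    by rewrite defA mul_row_col mul0mx add0r.
  by move=> i; rewrite mxE; case: splitP => j _; rewrite ?mxE.
pose t := (a *m x0) 0 0.
have [t_ge0|t_lt0] := leP 0 t.
  right; exists x0 => // i; rewrite defA mul_col_mx mxE.
  by case: splitP => j _ //; rewrite ord1.
have nz_t : t != 0 by rewrite lt_eqF.
case: (IHm (A' - t^-1 *: (A' *m x0 *m a)) (b - t^-1 *: (b *m x0 *m a))).
  case=> y y0; rewrite mulmxBr -scalemxAr !mulmxA => yb; left.
  (* The coefficient of [a] lost in the projection. It is nonnegative, since [b *m x0] is negative,
     [y *m A' *m x0] is nonnegative and [t < 0]. *)
  pose c := t^-1 * ((b *m x0) 0 0 - (y *m A' *m x0) 0 0).
  exists (row_mx c%:M y : 'rV_(1 + m)); last first.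
    rewrite defA mul_row_col mul_scalar_mx.
    apply/eqP; rewrite -subr_eq0; apply/eqP.
    have /eqP := yb; rewrite -subr_eq0 => /eqP <-.
    rewrite [b *m x0]mx11_scalar [y *m A' *m x0]mx11_scalar !mul_scalar_mx.
    apply/rowP => j; rewrite /c !mxE; ring.
  move=> i; rewrite mxE; case: splitP => j _ //; rewrite ord1 mxE eqxx mulr1n.
  apply: mulr_le0; first by rewrite invr_le0 ltW.
  rewrite subr_le0 (le_trans (ltW bx0)) // -mulmxA mxE.
  by apply: sumr_ge0 => k _; rewrite mulr_ge0.
case=> r Ar br; right.
(* The transposed projection applied to [r]: pairing a row with [r'] amounts to pairing its
   projection with [r]. *)
pose r' := r - t^-1 *: (x0 *m a *m r).
have r'E k (B : 'M_(k, d)) : B *m r' = (B - t^-1 *: (B *m x0 *m a)) *m r.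
  by rewrite /r' mulmxBr mulmxBl -scalemxAr -scalemxAl !mulmxA.
exists r'; last by rewrite r'E.
move=> i; rewrite defA mul_col_mx mxE; case: splitP => j _; last by rewrite r'E.
rewrite ord1 r'E [a *m x0]mx11_scalar mul_scalar_mx scalerA mulVf // scale1r.
by rewrite subrr mul0mx mxE.
Qed.

(** A linear relation between the rows allows moving [y] without changing [y *m A] until some
    coordinate vanishes; the corresponding row is deleted. *)
Lemma caratheodory (F : realFieldType) (d m : nat) (A : 'M[F]_(m, d)) (y : 'rV[F]_m) :
  (forall i, 0 <= y 0 i) ->
  exists (k : nat) (g : 'I_k -> 'I_m) (z : 'rV[F]_k),
    [/\ injective g, row_free (rowsub g A), (forall i, 0 <= z 0 i)
      & z *m rowsub g A = y *m A].
Proof.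
elim: m A y => [|m IHm] A y y0; last first.
  have [Afree|] := boolP (row_free A).
    by exists m.+1, id, y; split=> //; rewrite mxsub_id.
  rewrite -kermx_eq0 => /rowV0Pn[w /sub_kermxP wA nz_w].
  have [w' w'A [j w'j]] : exists2 w' : 'rV_m.+1, w' *m A = 0 & exists j, 0 < w' 0 j.
    have [j wj] := rV0Pn _ nz_w.
    case: (ltrgtP 0 (w 0 j)) wj => // wj _; first by exists w => //; exists j.
    by exists (- w); rewrite ?mulNmx ?wA ?oppr0 //; exists j; rewrite mxE oppr_gt0.
  (* The least ratio is the distance [y] can move along [- w'] before a coordinate turns negative;
     coordinate [i] reaches zero. *)
  have [i w'i imin] := @Order.TotalTheory.arg_minP _ _ _ j (fun k => 0 < w' 0 k)
    (fun k => y 0 k / w' 0 k) w'j.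
  pose t := y 0 i / w' 0 i.
  pose y1 := y - t *: w'.
  have t0 : 0 <= t by rewrite divr_ge0 // ltW.
  have y1_ge0 k : 0 <= y1 0 k.
    rewrite !mxE subr_ge0; have [w'k|w'k] := ltP 0 (w' 0 k).
      by rewrite -ler_pdivlMr // imin.
    by rewrite (le_trans _ (y0 k)) // mulr_ge0_le0.
  have y1i : y1 0 i = 0 by rewrite !mxE divfK ?subrr // gt_eqF.
  have y1A : y1 *m A = y *m A by rewrite mulmxBl -scalemxAl w'A scaler0 subr0.
  have y2_ge0 k : 0 <= (colsub (lift i) y1) 0 k by rewrite mxE.
  have [k [g [z [injg fg z0 zA]]]] := IHm (rowsub (lift i) A) _ y2_ge0.
  exists k, (lift i \o g), z; split => //.
  - by apply: inj_comp => //; apply: lift_inj.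
  - by rewrite rowsub_comp.
  - rewrite rowsub_comp zA -y1A; apply/rowP => l.
    rewrite !mxE [RHS](bigD1_ord i) //= y1i mul0r add0r.
    by apply: eq_bigr => j' _; rewrite !mxE.
exists 0, id, 0; split=> //; first by rewrite /row_free -leqn0 rank_leq_row.
  by move=> [].
by rewrite !flatmx0 [y]thinmx0.
Qed.

(* Moving [r] inside the hyperplane [b r = const] until no further inequality
   can be made tight leaves [r] determined, up to scaling and up to the kernel
   of [A] and [b], by its tight constraints. *)
Lemma tight_separation (F : realFieldType) (d m : nat) (A : 'M[F]_(m, d))
    (b : 'rV[F]_d) (r : 'cV[F]_d) :
  (forall i, 0 <= (A *m r) i 0) -> (b *m r) 0 0 < 0 ->
  exists r' : 'cV[F]_d,
    [/\ forall i, 0 <= (A *m r') i 0, (b *m r') 0 0 < 0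
      & forall w : 'cV[F]_d, b *m w = 0 ->
          (forall i, (A *m r') i 0 = 0 -> (A *m w) i 0 = 0) -> A *m w = 0].
Proof.
pose P (r : 'cV[F]_d) := [set i | (A *m r) i 0 == 0].
have [n] := ubnP (m - #|P r|)%N; elim: n r => // n IHn r /ltnSE len Ar br.
have [tight|] := pselect (forall w : 'cV[F]_d, b *m w = 0 ->
  (forall i, (A *m r) i 0 = 0 -> (A *m w) i 0 = 0) -> A *m w = 0).
  by exists r.
move=> /existsNP[w /not_implyP[bw /not_implyP[Pw /eqP/matrix0Pn[j0 [k]]]]].
rewrite [k]ord1 => {k} nz_w.
have {w bw Pw nz_w} [w [bw Pw [j wj]]] : exists w : 'cV[F]_d, [/\ b *m w = 0,
    forall i, (A *m r) i 0 = 0 -> (A *m w) i 0 = 0 & exists j, (A *m w) j 0 < 0].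
  case: (ltrgtP 0 ((A *m w) j0 0)) nz_w => // wj0 _; last first.
    by exists w; split=> //; exists j0.
  exists (- w); rewrite !mulmxN bw oppr0; split=> // [i /Pw wi0|].
    by rewrite mxE wi0 oppr0.
  by exists j0; rewrite mxE oppr_lt0.
(* The longest admissible step along [w]: tight constraints stay tight and [i] becomes tight, so the
   number of slack constraints drops. *)
have [i wi imin] := @Order.TotalTheory.arg_minP _ _ _ j (fun k => (A *m w) k 0 < 0)
  (fun k => (A *m r) k 0 / - (A *m w) k 0) wj.
pose t := (A *m r) i 0 / - (A *m w) i 0.
have t0 : 0 <= t by rewrite divr_ge0 // oppr_ge0 ltW.
have AE k : (A *m (r + t *: w)) k 0 = (A *m r) k 0 + t * (A *m w) k 0.
  by rewrite mulmxDr -scalemxAr mxE; congr (_ + _); rewrite mxE.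
apply: (IHn (r + t *: w)).
- apply: leq_trans len; apply: ltn_sub2l.
    rewrite -[m in (_ < m)%N]card_ord -cardsT; apply: proper_card.
    rewrite properT; apply: contraTneq wi => PT.
    have := in_setT i; rewrite -PT inE => /eqP/Pw->; by rewrite ltxx.
  apply: proper_card; apply/properP; split.
    apply/subsetP => k; rewrite !inE AE => /eqP kP.
    by rewrite kP Pw // mulr0 addr0.
  exists i; rewrite inE ?AE.
    by rewrite /t invrN mulrN mulNr divfK ?subrr // lt_eqF.
  by apply: contraTneq wi => /Pw->; rewrite ltxx.
- move=> k; rewrite AE; have [wk|wk] := ltP ((A *m w) k 0) 0.
    by rewrite -[_ * _]opprK -mulrN subr_ge0 -ler_pdivlMr ?oppr_gt0 // imin.
  by rewrite addr_ge0 // mulr_ge0.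
by rewrite mulmxDr -scalemxAr bw scaler0 addr0.
Qed.

(** * Integral certificates *)

Lemma ler_norm_det (k D : nat) (B : 'M[int]_k) :
  (forall i j, `|B i j| <= D%:Z) -> `|\det B| <= (k`! * D ^ k)%N%:Z.
Proof.
move=> BD; rewrite /determinant (le_trans (ler_norm_sum _ _ _)) //.
apply: (@le_trans _ _ (\sum_(s : 'S_k) (D ^ k)%N%:Z)).
  apply: ler_sum => s _; rewrite normrM normr_sign mul1r normr_prod.
  apply: (@le_trans _ _ (\prod_(i < k) D%:Z)).
    by apply: ler_prod => i _; rewrite normr_ge0 BD.
  by rewrite prodr_const card_ord -[(D ^ k)%N%:Z]natz natrX natz.
by rewrite sumr_const card_Sn -mulr_natl natz -PoszM.
Qed.

Lemma ler_norm_adj (k D : nat) (B : 'M[int]_k) i j :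
  (forall i j, `|B i j| <= D%:Z) ->
  `|(\adj B) i j| <= (k.-1`! * D ^ k.-1)%N%:Z.
Proof.
move=> BD; rewrite mxE /cofactor normrM normrX normrN1 expr1n mul1r.
by apply: ler_norm_det => i' j'; rewrite !mxE.
Qed.

Lemma row_free_minor (F : fieldType) (k d : nat) (C : 'M[F]_(k, d)) :
  row_free C -> exists2 g : 'I_k -> 'I_d, injective g & \det (colsub g C) != 0.
Proof.
rewrite /row_free -mxrank_tr => Cfree.
exists (fullrankfun Cfree); first exact: fullrankfun_inj.
have := fullrowsub_unit Cfree.
by rewrite unitmxE unitfE -det_tr trmx_mxsub trmxK.
Qed.

Lemma row_free_int_minor (k d : nat) (C : 'M[int]_(k, d)) :
  row_free (map_mx intr C : 'M[rat]_(k, d)) ->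
  exists2 g : 'I_k -> 'I_d, injective g & \det (colsub g C) != 0.
Proof.
case/row_free_minor=> g injg nz; exists g => //; apply: contraNneq nz => det0.
by rewrite -map_mxsub det_map_mx det0.
Qed.

Lemma fact_leq_exp (k d : nat) : (k <= d)%N -> (k`! <= d ^ k)%N.
Proof.
elim: k => // k IHk ltkd.
by rewrite factS expnS leq_mul // IHk // ltnW.
Qed.

Lemma leq_fact_exp (k d D : nat) :
  (0 < d)%N -> (0 < D)%N -> (k <= d)%N -> (k`! * D ^ k <= (d * D) ^ d)%N.
Proof.
move=> d0 D0 lekd; apply: (@leq_trans ((d * D) ^ k)).
  by rewrite expnMn leq_mul // fact_leq_exp.
by rewrite leq_pexp2l // muln_gt0 d0.
Qed.

Local Notation ratmx := (map_mx (intr : int -> rat)).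

Lemma ratmx_inj (m n : nat) : injective (ratmx : 'M_(m, n) -> 'M_(m, n)).
Proof.
move=> A B /matrixP AB; apply/matrixP => i j.
by have := AB i j; rewrite !mxE => /intr_inj.
Qed.

(** Cramer's rule on a nonsingular maximal minor [Cg]: with [q] the absolute value of its
    determinant, [q] times [z] is integral, still nonnegative, and expressed by cofactors. *)
Lemma int_conic_combination (k d D X : nat) (C : 'M[int]_(k, d))
    (x : 'rV[int]_d) (z : 'rV[rat]_k) :
  (0 < d)%N -> (0 < D)%N ->
  (forall i j, `|C i j| <= D%:Z) -> (forall j, `|x 0 j| <= X%:Z) ->
  row_free (ratmx C) -> (forall i, 0 <= z 0 i) -> z *m ratmx C = ratmx x ->
  exists (q : nat) (c : 'I_k -> nat),
    [/\ (0 < q <= (d * D) ^ d)%N, (forall i, (c i <= (d * D) ^ d * X)%N)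
      & x *+ q = \sum_i row i C *+ c i].
Proof.
move=> d0 D0 CD xX Cfree z0 zC.
have lekd : (k <= d)%N by move: Cfree; rewrite /row_free => /eqP<-; apply: rank_leq_col.
have [g injg nz] := row_free_int_minor Cfree.
set Cg := colsub g C in nz.
(* The sign turns the factor [\det Cg] of Cramer's rule into its absolute value. *)
pose c := Num.sg (\det Cg) *: (colsub g x *m \adj Cg).
have CgD i j : `|Cg i j| <= D%:Z by rewrite mxE.
have cE : ratmx c = (`|\det Cg|)%:~R *: z.
  have zCg : z *m ratmx Cg = ratmx (colsub g x).
    by rewrite /Cg !map_mxsub -zC; apply/rowP => j; rewrite !mxE; apply: eq_bigr => i _; rewrite !mxE.
  rewrite /c map_mxZ map_mxM -zCg -mulmxA -map_mxM mul_mx_adj map_scalar_mx.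
  by rewrite mul_mx_scalar scalerA -intrM -normrEsg.
have c_ge0 i : 0 <= c 0 i.
  rewrite -(ler0z rat); have /rowP/(_ i) := cE; rewrite mxE => ->.
  by rewrite mxE mulr_ge0 // ler0z.
have cX i : c 0 i <= ((d * D) ^ d * X)%N%:Z.
  rewrite -[leLHS]ger0_norm // mxE normrM normr_sg nz mul1r mxE.
  apply: (le_trans (ler_norm_sum _ _ _)).
  apply: (@le_trans _ _ (\sum_(l < k) (X * (k.-1`! * D ^ k.-1))%N%:Z)).
    by apply: ler_sum => l _; rewrite normrM PoszM ler_pM // ?ler_norm_adj // mxE.
  rewrite sumr_const card_ord -mulr_natl natz -PoszM lez_nat.
  have -> : (k * (X * (k.-1`! * D ^ k.-1)) = k * k.-1`! * D ^ k.-1 * X)%N by ring.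
  rewrite leq_mul2r; apply/orP; right.
  apply: leq_trans (leq_fact_exp d0 D0 lekd).
  case: (k) => [|k'] //; rewrite factS leq_mul2l leq_pexp2l ?orbT //.
exists (absz (\det Cg)), (fun i => absz (c 0 i)); split.
- rewrite absz_gt0 nz /=.
  rewrite -lez_nat abszE; apply: le_trans (ler_norm_det CgD) _.
  by rewrite lez_nat leq_fact_exp.
- by move=> i; rewrite -lez_nat abszE ger0_norm.
apply: ratmx_inj; rewrite -scaler_nat map_mxZ -zC natz abszE scalemxAl -cE.
rewrite -map_mxM; congr (ratmx _); rewrite mulmx_sum_row; apply: eq_bigr => i _.
by rewrite -scaler_nat natz abszE ger0_norm.
Qed.

(** A maximal minor yields an integral multiple [R] of a projection onto the kernel of [C]; as [b]
    lies outside the row space, some column of [R] is not orthogonal to [b]. *)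
Lemma int_normal (k d D : nat) (C : 'M[int]_(k, d)) (b : 'rV[rat]_d) :
  (0 < d)%N -> (0 < D)%N -> (forall i j, `|C i j| <= D%:Z) ->
  row_free (ratmx C) -> ~~ (b <= ratmx C)%MS ->
  exists h : 'cV[int]_d,
    [/\ (forall j, `|h j 0| <= (2 * (d * D) ^ d)%N%:Z), C *m h = 0
      & b *m ratmx h != 0].
Proof.
move=> d0 D0 CD Cfree bC.
have lekd : (k <= d)%N by move: Cfree; rewrite /row_free => /eqP<-; apply: rank_leq_col.
have [g injg nz] := row_free_int_minor Cfree.
set Cg := colsub g C in nz.
have CgD i j : `|Cg i j| <= D%:Z by rewrite mxE.
pose E : 'M[int]_(d, k) := colsub g 1%:M.
have CE : C *m E = Cg.
  by rewrite /E mulmx_colsub mulmx1.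
(* The columns of [R] span the kernel of [C]. *)
pose R := (\det Cg)%:M - E *m \adj Cg *m C.
have CR : C *m R = 0.
  by rewrite mulmxBr !mulmxA CE mul_mx_adj mul_mx_scalar mul_scalar_mx subrr.
have bR : b *m ratmx R != 0.
  apply: contraNneq bC; rewrite map_mxB mulmxBr => /eqP.
  rewrite subr_eq0 map_scalar_mx mul_mx_scalar !map_mxM !mulmxA => /eqP bE.
  have nzq : (\det Cg)%:~R != 0 :> rat by rewrite intr_eq0.
  by rewrite -(eqmx_scale b nzq) bE submxMl.
have [i [j]] := matrix0Pn _ bR; rewrite [i]ord1 => {i} bRj.
exists (col j R); split.
(* The factor 2 of the bound: one summand for the determinant on the diagonal, one for an entry of
   [E *m \adj Cg *m C]. *)
- move=> i; rewrite mxE /R mxE [X in _ + X]mxE.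
  apply: (le_trans (ler_normB _ _)); rewrite mul2n -addnn PoszD lerD //.
    rewrite mxE; case: (i == j); rewrite ?mulr0n ?normr0 // mulr1n.
    by rewrite (le_trans (ler_norm_det CgD)) // lez_nat leq_fact_exp.
  rewrite -mulmxA mxE.
  (* Row [i] of [E] is the [l]-th unit vector if [i = g l], and zero if [i] is not a value of
     [g]. *)
  have [/existsP[l /eqP gl]|] := boolP [exists l, g l == i]; last first.
    move=> /existsPn gi; rewrite big1 ?normr0 // => l _.
    by rewrite !mxE eq_sym (negPf (gi l)) mul0r.
  rewrite (bigD1 l) //= big1 => [|l' l'l]; last first.
    by rewrite !mxE -gl (inj_eq injg) eq_sym (negPf l'l) mul0r.
  rewrite addr0 !mxE gl eqxx mul1r (le_trans (ler_norm_sum _ _ _)) //.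
  apply: (@le_trans _ _ (\sum_(l < k) (k.-1`! * D ^ k.-1 * D)%N%:Z)).
    by apply: ler_sum => l' _; rewrite normrM PoszM ler_pM // ler_norm_adj.
  rewrite sumr_const card_ord -mulr_natl natz -PoszM lez_nat.
  apply: leq_trans (leq_fact_exp d0 D0 lekd).
  by case: (k) => [|k'] //; rewrite factS expnSr !mulnA.
- by rewrite colE mulmxA CR mul0mx.
apply/matrix0Pn; exists 0, 0.
by rewrite map_col colE mulmxA -colE mxE.
Qed.

(** The bounds do not depend on the number [m] of rows: a conic combination is reduced to
    independent rows, and a separator is replaced by an integral normal to its tight rows. *)
Lemma bounded_farkas_mx (m d D X : nat) (A : 'M[int]_(m, d)) (x : 'rV[int]_d) :
  (0 < d)%N -> (0 < D)%N ->
  (forall i j, `|A i j| <= D%:Z) -> (forall j, `|x 0 j| <= X%:Z) ->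
  (exists (q : nat) (c : 'I_m -> nat),
    [/\ (0 < q <= (d * D) ^ d)%N, (forall i, (c i <= (d * D) ^ d * X)%N)
      & x *+ q = \sum_i row i A *+ c i]) \/
  (exists h : 'cV[int]_d,
    [/\ (forall j, `|h j 0| <= (2 * (d * D) ^ d)%N%:Z),
        (forall i, 0 <= (A *m h) i 0) & (x *m h) 0 0 < 0]).
Proof.
move=> d0 D0 AD xX.
case: (farkas (ratmx A) (ratmx x)) => [[y y0 yA]|[r0 Ar0 xr0]].
  left; have [k [g [z [injg gfree z0 zE]]]] := caratheodory (ratmx A) y0.
  rewrite -map_mxsub yA in gfree zE.
  have gAD i j : `|(rowsub g A) i j| <= D%:Z by rewrite mxE.
  have [q [c [q_le c_le xq]]] := int_conic_combination d0 D0 gAD xX gfree z0 zE.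
  (* Since [g] is injective, each sum has at most one term, so the bound on [c] carries over. *)
  exists q, (fun i => \sum_(l | g l == i) c l)%N; split=> //.
    move=> i; have [/existsP[l /eqP gl]|] := boolP [exists l, g l == i].
      by rewrite (big_pred1 l) // => l'; rewrite /= -gl (inj_eq injg).
    by move=> /existsPn gi; rewrite big1 // => l; rewrite (negPf (gi l)).
  rewrite xq [LHS](partition_big g predT) //=; apply: eq_bigr => i _.
  rewrite -sumrMnr; apply: eq_bigr => l /eqP gl.
  by rewrite row_rowsub gl.
right.
have [r [Ar xr tight]] := tight_separation Ar0 xr0.
pose P := [set i | (ratmx A *m r) i 0 == 0].
pose f := fun l : 'I_#|P| => enum_val l.
pose B := rowsub f A.
pose e := maxrankfun (ratmx B).
have Cfree : row_free (ratmx (rowsub e B)) by rewrite map_mxsub maxrowsub_free.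
have CD i j : `|(rowsub e B) i j| <= D%:Z by rewrite !mxE.
have Br : ratmx B *m r = 0.
  apply/colP => l; rewrite map_mxsub mul_rowsub_mx [RHS]mxE [LHS]mxE.
  by have := enum_valP l; rewrite inE => /eqP.
(* [r] annihilates the span of the tight rows but not [x]. *)
have xC : ~~ (ratmx x <= ratmx (rowsub e B))%MS.
  apply/negP; rewrite map_mxsub eq_maxrowsub => /submxP[u xE].
  by move: xr; rewrite xE -mulmxA Br mulmx0 mxE ltxx.
have [h0 [h0D Ch0 xh0]] := int_normal d0 D0 CD Cfree xC.
have [h [hD Ch xh]] : exists h : 'cV[int]_d,
    [/\ (forall j, `|h j 0| <= (2 * (d * D) ^ d)%N%:Z), rowsub e B *m h = 0
      & (ratmx x *m ratmx h) 0 0 < 0].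
  have [i [j]] := matrix0Pn _ xh0; rewrite [i]ord1 [j]ord1.
  move=> {i j}; case: (ltrgtP ((ratmx x *m ratmx h0) 0 0) 0) => // xh0_sgn _.
    by exists h0.
  exists (- h0); rewrite mulmxN Ch0 oppr0 map_mxN mulmxN; split=> //.
    by move=> l; rewrite mxE normrN.
  by rewrite mxE oppr_lt0.
have Bh : ratmx B *m ratmx h = 0.
  have /submxP[u ->] : (ratmx B <= ratmx (rowsub e B))%MS.
    by rewrite map_mxsub eq_maxrowsub.
  by rewrite -mulmxA -map_mxM Ch map_mx0 mulmx0.
exists h; split=> //; last by move: xh; rewrite -map_mxM mxE ltrz0.
(* With this [t], [x] annihilates [ratmx h - t *: r], so tightness gives that [A] does too. Hence
   [A] takes on [h] the values of [t *: r], which are nonnegative. *)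
pose t := (ratmx x *m ratmx h) 0 0 / (ratmx x *m r) 0 0.
have t_ge0 : 0 <= t by rewrite mulr_le0 ?invr_le0 // ltW.
have Aw : ratmx A *m (ratmx h - t *: r) = 0.
  apply: tight.
    rewrite mulmxBr -scalemxAr; apply/rowP => i; rewrite [i]ord1.
    rewrite mxE [X in _ + X]mxE [X in _ - X]mxE [RHS]mxE /t divfK ?subrr //.
    by rewrite lt_eqF.
  move=> i Ai; have iP : i \in P by rewrite inE Ai.
  have BiE (w : 'cV_d) : (ratmx A *m w) i 0 = (ratmx B *m w) (enum_rank_in iP i) 0.
    by rewrite map_mxsub mul_rowsub_mx [RHS]mxE /f enum_rankK_in.
  by rewrite BiE mulmxBr -scalemxAr Bh Br scaler0 subr0 mxE.
move=> i; rewrite -(ler0z rat).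
have -> : ((A *m h) i 0)%:~R = (ratmx A *m ratmx h) i 0 by rewrite -map_mxM [RHS]mxE.
move: Aw; rewrite mulmxBr -scalemxAr => /eqP; rewrite subr_eq0 => /eqP->.
by rewrite mxE mulr_ge0.
Qed.

(** * A small common multiple *)

Section CommonMultiple.
Local Open Scope nat_scope.

(** Legendre's formula: the [i]-th term for [n.*2] is at least twice that for [n], and strictly more
    at [i = k], where the quotients are positive and zero. *)
Lemma dvdn_bin_doublen (p k n : nat) :
  prime p -> 0 < k -> n < p ^ k <= n.*2 -> p %| 'C(n.*2, n).
Proof.
move=> p_pr k0 /andP[ltn le2n].
have n0 : 0 < n by rewrite -double_gt0 (leq_trans _ le2n) // (leq_ltn_trans _ ltn).
have p1 := prime_gt1 p_pr.
have Cgt0 : 0 < 'C(n.*2, n) by rewrite bin_gt0 -addnn leq_addr.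
suff : 0 < logn p 'C(n.*2, n) by rewrite logn_gt0 mem_primes => /and3P[].
have := bin_fact (leq_addr n n : n <= n + n); rewrite addnK addnn => /(congr1 (logn p)).
rewrite lognM ?muln_gt0 ?fact_gt0 // lognM ?fact_gt0 //.
rewrite !logn_fact // => E.
have kle : k < (n.*2).+1.
  by rewrite ltnS (leq_trans _ le2n) // ltnW // ltn_expl.
suff : (\sum_(1 <= i < n.+1) n %/ p ^ i).*2 < \sum_(1 <= i < (n.*2).+1) n.*2 %/ p ^ i.
  by rewrite -addnn -E -[X in X < _]add0n ltn_add2r.
(* The added terms vanish because [p ^ i] exceeds [i], hence [n]. *)
have -> : \sum_(1 <= i < n.+1) n %/ p ^ i = \sum_(1 <= i < (n.*2).+1) n %/ p ^ i.
  rewrite [RHS](@big_cat_nat _ _ _ n.+1) //= ?ltnS -?addnn ?leq_addr //.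
  rewrite [X in _ = _ + X]big_nat_cond [X in _ = _ + X]big1 ?addn0 // => i /andP[/andP[ni _] _].
  by rewrite divn_small // (leq_trans ni) // ltnW // ltn_expl.
rewrite -mul2n big_distrr /=.
rewrite (@bigD1_seq _ _ _ _ _ k) ?mem_index_iota ?iota_uniq ?k0 //=.
rewrite [X in _ < X](@bigD1_seq _ _ _ _ _ k) ?mem_index_iota ?iota_uniq ?k0 //=.
rewrite (divn_small ltn) muln0 -addSn leq_add //.
  by rewrite divn_gt0 // expn_gt0 ltnW.
by apply: leq_sum => i _; rewrite -mul2n leq_divRL ?expn_gt0 ?(ltnW p1) // -mulnA leq_mul2l leq_trunc_div.
Qed.

Lemma dvdn_prime_powers (m L : nat) :
  0 < L -> (forall p k, prime p -> 0 < k -> p ^ k %| m -> p ^ k %| L) ->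
  0 < m -> m %| L.
Proof.
move=> L0 H m0; apply/dvdn_partP => // p; rewrite mem_primes => /and3P[pp _ pm].
rewrite p_part; apply: H => //; last by rewrite pfactor_dvdnn.
by rewrite logn_gt0 mem_primes pp m0.
Qed.

(* A prime power in the interval from [n.+1] to [n.*2] exceeds the [p]-part of
   [L] by one factor [p], which ['C(n.*2, n)] supplies. *)
Lemma common_multiple_doublen (n L : nat) : 0 < L ->
  (forall q, 0 < q <= n -> q %| L) ->
  forall q, 0 < q <= n.*2 -> q %| L * 'C(n.*2, n).
Proof.
move=> L0 LP q /andP[q0 qn].
apply: dvdn_prime_powers => // [|p k pp k0 pkq].
  by rewrite muln_gt0 L0 bin_gt0 -addnn leq_addr.
have pk0 : 0 < p ^ k by rewrite expn_gt0 prime_gt0.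
have [lepn|ltnp] := leqP (p ^ k) n; first by rewrite dvdn_mulr // LP // pk0.
have le2n : p ^ k <= n.*2 by rewrite (leq_trans _ qn) // dvdn_leq.
case: k => // k in k0 pkq pk0 ltnp le2n *.
rewrite expnSr dvdn_mul //; last by rewrite (@dvdn_bin_doublen p k.+1) ?ltnp.
apply: LP; rewrite expn_gt0 prime_gt0 //=.
have := leq_trans (leq_mul (leqnn (p ^ k)) (prime_gt1 pp)) (eq_leq (esym (expnSr p k))).
by move=> /leq_trans /(_ le2n); rewrite muln2 leq_double.
Qed.

Lemma bin_leq_exp2 (n k : nat) : 'C(n, k) <= 2 ^ n.
Proof.
elim: n k => [|n IHn] [|k] //; first by rewrite bin0 expn_gt0.
by rewrite binS expnS mul2n -addnn leq_add.
Qed.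

(** Each doubling multiplies [L] by a central binomial coefficient, at most
    [2 ^ (2 ^ j.+1) = 4 ^ (2 ^ j)], which squares the bound. *)
Lemma common_multiple_expn (j : nat) : exists2 L : nat,
  0 < L <= 4 ^ (2 ^ j) & forall q, 0 < q <= 2 ^ j -> q %| L.
Proof.
elim: j => [|j [L /andP[L0 Lle] LP]].
  by exists 1 => // q; rewrite expn0 -eqn_leq => /eqP<-.
exists (L * 'C((2 ^ j).*2, 2 ^ j)).
  rewrite muln_gt0 L0 bin_gt0 -addnn leq_addr /= addnn.
  rewrite expnS mul2n -addnn expnD addnn leq_mul //.
  by rewrite (leq_trans (bin_leq_exp2 _ _)) // -mul2n expnM.
by move=> q; rewrite expnS mul2n; apply: common_multiple_doublen.
Qed.

Lemma small_common_multiple (M : nat) : 0 < M -> exists2 L : nat,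
  0 < L <= 2 ^ (4 * M) & forall q, 0 < q <= M -> q %| L.
Proof.
move=> M0; have [L /andP[L0 Lle] LP] := common_multiple_expn (up_log 2 M).
have Mle : M <= 2 ^ up_log 2 M by apply: up_logP.
exists L; last by move=> q /andP[q0 qM]; rewrite LP // q0 (leq_trans qM).
(* Rounding [M] up to a power of two gives at most [2 * M], and [4 ^ (2 * M) = 2 ^ (4 * M)]. *)
rewrite L0 (leq_trans Lle) // -[4 * M]/(2 * 2 * M) -mulnA -[4]/(2 ^ 2) -expnM.
rewrite leq_exp2l // leq_mul2l /=.
have [->//|M1] : M = 1 \/ 1 < M by case: (M) M0 => [|[|]]; [|left|right].
have /andP[+ _] := up_log_bounds (isT : 1 < 2) M1.
case: (up_log 2 M) => [|j] /= ltj; first by rewrite expn0 muln_gt0.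
by rewrite expnS leq_mul2l /= ltnW.
Qed.

End CommonMultiple.

(** * Nearby cones share a short vector *)

(** Coefficients indexed by vectors instead of row positions can be compared with multiplicities in
    a multiset. *)
Lemma bounded_farkas (d D X : nat) (s : seq 'rV[int]_d) (x : 'rV[int]_d) :
  (0 < d)%N -> (0 < D)%N -> uniq s ->
  (forall v, v \in s -> forall j, `|v 0 j| <= D%:Z) ->
  (forall j, `|x 0 j| <= X%:Z) ->
  (exists (q : nat) (c : 'rV[int]_d -> nat),
    [/\ (0 < q <= (d * D) ^ d)%N, (forall v, (c v <= (d * D) ^ d * X)%N)
      & x *+ q = \sum_(v <- s) v *+ c v]) \/
  (exists h : 'cV[int]_d,
    [/\ (forall j, `|h j 0| <= (2 * (d * D) ^ d)%N%:Z),
        (forall v, v \in s -> 0 <= (v *m h) 0 0) & (x *m h) 0 0 < 0]).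
Proof.
move=> d0 D0 s_uniq sD xX.
pose A : 'M_(size s, d) := \matrix_i s`_i.
have AD i j : `|A i j| <= D%:Z by rewrite mxE sD // mem_nth.
case: (bounded_farkas_mx d0 D0 AD xX) => [[q [c [qD cX xq]]]|[h [hD Ah xh]]].
  left; exists q, (fun v => if insub (index v s) is Some i then c i else 0%N).
  split=> //; first by move=> v; case: insub.
  rewrite xq [RHS](big_nth 0) big_mkord; apply: eq_bigr => i _.
  by rewrite rowK index_uniq // valK.
right; exists h; split=> // v vs; pose i := Ordinal (eq_ind_r is_true vs (index_mem v s)).
by have := Ah i; rewrite -[v](nth_index 0 vs) !mxE; under eq_bigr do rewrite mxE.
Qed.

(** As an explicit list, the cube supplies the finitely many candidate normals, and its length
    bounds both their number and the number of distinct vectors in a [T i]. *)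
Definition box (d D : nat) : seq 'rV[int]_d :=
  [seq \row_j ((g j : nat)%:Z - D%:Z) | g : {ffun 'I_d -> 'I_(D.*2.+1)}].

Lemma size_box (d D : nat) : size (box d D) = (D.*2.+1 ^ d)%N.
Proof. by rewrite size_map -cardE card_ffun !card_ord. Qed.

Lemma mem_box (d D : nat) (v : 'rV[int]_d) :
  (v \in box d D) = [forall j, `|v 0 j| <= D%:Z].
Proof.
apply/imageP/forallP => [[g _ ->] j|vD].
  have : (g j <= D + D)%N by rewrite addnn -ltnS ltn_ord.
  rewrite mxE ler_norml; move: (nat_of_ord (g j)) => a.
  by rewrite -lez_nat PoszD lerBlDr => ->; rewrite lerBrDr addNr.
exists [ffun j => inord (absz (v 0 j + D%:Z))] => //.
apply/rowP => j; have := vD j; rewrite ler_norml => /andP[vlo vhi].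
have vD0 : 0 <= v 0 j + D%:Z by rewrite -lerBlDr sub0r.
rewrite mxE ffunE inordK; first by rewrite gez0_abs // addrK.
by rewrite ltnS -lez_nat gez0_abs // -addnn PoszD lerD2r.
Qed.

Lemma dotmxC (R : comNzRingType) (d : nat) (u v : 'rV[R]_d) :
  (u *m v^T) 0 0 = (v *m u^T) 0 0.
Proof. by rewrite -[v in RHS]trmxK -trmx_mul [RHS]mxE. Qed.

Lemma dotmx_natmul (d k : nat) (u : 'rV[int]_d) (z : 'cV[int]_d) :
  (u *+ k *m z) 0 0 = (u *m z) 0 0 *+ k.
Proof. by rewrite -scaler_nat -scalemxAl mxE mulr_natl. Qed.

Lemma dotmx_sum (d : nat) (s : seq 'rV[int]_d) (c : 'rV[int]_d -> nat)
    (z : 'cV[int]_d) :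
  ((\sum_(v <- s) v *+ c v) *m z) 0 0 = \sum_(v <- s) (v *m z) 0 0 *+ c v.
Proof.
by rewrite mulmx_suml summxE; apply: eq_bigr => v _; rewrite dotmx_natmul.
Qed.

Lemma ler_norm_dotmx (d a c : nat) (u v : 'rV[int]_d) :
  (forall j, `|u 0 j| <= a%:Z) -> (forall j, `|v 0 j| <= c%:Z) ->
  `|(u *m v^T) 0 0| <= (d * a * c)%N%:Z.
Proof.
move=> ua vc; rewrite mxE (le_trans (ler_norm_sum _ _ _)) //.
apply: (@le_trans _ _ (\sum_(j < d) (a * c)%N%:Z)).
  by apply: ler_sum => j _; rewrite normrM mxE PoszM ler_pM.
by rewrite sumr_const card_ord -mulr_natl natz -PoszM mulnA.
Qed.

(** Duality used twice: the normals of all the cones become generators, and a vector nonnegative on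
    every short normal lies in every cone. *)
Lemma cone_intersection (d D n e : nat) (U : 'I_n -> seq 'rV[int]_d)
    (w : 'I_n -> 'rV[int]_d -> nat) (b : 'rV[int]_d) (j : 'I_d)
    (X := ((d * D) ^ d)%N) (Y := ((d * (2 * X)) ^ d)%N) :
  (0 < d)%N -> (0 < D)%N ->
  (forall i, uniq (U i)) ->
  (forall i v, v \in U i -> forall l, `|v 0 l| <= D%:Z) ->
  (forall i l, `|(b - \sum_(v <- U i) v *+ w i v) 0 l| <= e%:Z) ->
  ((4 * X).+1 ^ d * Y * (d * (2 * X) * e))%N%:Z < `|b 0 j| ->
  exists r : 'rV[int]_d, [/\ r != 0, (forall l, `|r 0 l| <= (2 * Y)%N%:Z)
    & forall i, exists (q : nat) (c : 'rV[int]_d -> nat),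
      [/\ (0 < q <= X)%N, (forall v, (c v <= X * (2 * Y))%N)
        & r *+ q = \sum_(v <- U i) v *+ c v]].
Proof.
move=> d0 D0 Uuniq UD Ub bj.
have X0 : (0 < X)%N by rewrite expn_gt0 muln_gt0 d0 D0.
(* All short normals of all the cones at once; they lie in one box, so their number is bounded
   independently of [n]. *)
pose H := [seq h <- undup (box d (2 * X)) |
  [exists i, all (fun u : 'rV_d => 0 <= (u *m h^T) 0 0) (U i)]].
have Huniq : uniq H by rewrite filter_uniq // undup_uniq.
have HD h : h \in H -> forall l, `|h 0 l| <= (2 * X)%N%:Z.
  by rewrite mem_filter mem_undup mem_box => /andP[_ /forallP].
have sizeH : (size H <= (4 * X).+1 ^ d)%N.
  rewrite -[(4 * X)%N]/(2 * 2 * X)%N -mulnA mul2n -size_box.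
  by rewrite (leq_trans (size_subseq (filter_subseq _ _))) // size_undup.
(* Chosen so that its pairing with [b] is minus the absolute value of [b 0 j]. *)
pose x : 'rV[int]_d := - Num.sg (b 0 j) *: delta_mx 0 j.
have x1 l : `|x 0 l| <= 1%N%:Z.
  rewrite !mxE normrM normrN normr_sg eqxx /=.
  by case: (b 0 j == 0); case: (l == j).
have xE (u : 'rV[int]_d) : (x *m u^T) 0 0 = - Num.sg (b 0 j) * u 0 j.
  by rewrite -scalemxAl -rowE !mxE.
have DX : (0 < 2 * X)%N by rewrite muln_gt0.
case: (bounded_farkas d0 DX Huniq HD x1) => [[q [c [qY cY xq]]]|[h [hY Hh xh]]].
  exfalso; move: bj; rewrite ltNge => /negP; apply.
  (* A normal of the [i]-th cone is nonnegative on the conic sum over [U i], so only the error term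
     can contribute negatively. Pairing [xq] with [b] then bounds [b 0 j]. *)
  have Hb h : h \in H -> - (d * (2 * X) * e)%N%:Z <= (h *m b^T) 0 0.
    move=> hH; have := hH; rewrite mem_filter => /andP[/existsP[i /allP Ui] _].
    have -> : b = (b - \sum_(v <- U i) v *+ w i v) + \sum_(v <- U i) v *+ w i v.
      by rewrite subrK.
    rewrite linearD mulmxDr mxE -[leLHS]addr0 lerD //.
      rewrite lerNl (le_trans (ler_norm _)) // normrN.
      by rewrite ler_norm_dotmx //; apply: HD.
    rewrite dotmxC dotmx_sum big_seq sumr_ge0 // => v vU.
    by rewrite mulrn_wge0 // Ui.
  have := congr1 (fun u : 'rV_d => (u *m b^T) 0 0) xq.
  rewrite /= dotmx_sum dotmx_natmul xE mulNr -normrEsg mulNrn => bqE.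
  have /andP[q0 _] := qY.
  apply: (@le_trans _ _ (`|b 0 j| *+ q)); first by rewrite -[leLHS]mulr1n ler_wpMn2l.
  rewrite -[leLHS]opprK bqE lerNl.
  apply: (@le_trans _ _ (\sum_(h <- H) - (Y * (d * (2 * X) * e))%N%:Z)).
    rewrite big_const_seq count_predT iter_addr_0 mulNrn lerN2 -mulr_natl natz.
    by rewrite -PoszM lez_nat mulnA !leq_mul.
  rewrite big_seq [leRHS]big_seq; apply: ler_sum => h hH.
  apply: (@le_trans _ _ (- (d * (2 * X) * e)%N%:Z *+ c h)).
    rewrite mulNrn lerN2 -mulr_natl natz -PoszM lez_nat leq_mul //.
    by have := cY h; rewrite muln1.
  by rewrite ler_wMn2r // Hb.
exists h^T; split.
- by apply: contraTneq xh => h0; rewrite -[h]trmxK h0 trmx0 mulmx0 mxE ltxx.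
- by move=> l; rewrite mxE.
move=> i; have hTY l : `|h^T 0 l| <= (2 * Y)%N%:Z by rewrite mxE.
case: (bounded_farkas d0 D0 (Uuniq i) (UD i) hTY) => // -[h' [h'X Uh' hh']].
(* A separator of [h] from the [i]-th cone would itself be a short normal, on which [h] is
   nonnegative. *)
suff /Hh : h'^T \in H.
  by move: hh'; rewrite -[h' in X in X -> _]trmxK dotmxC trmxK ltNge => /negP.
rewrite mem_filter mem_undup mem_box; apply/andP; split.
  by apply/existsP; exists i; apply/allP => u uU; rewrite trmxK Uh'.
by apply/forallP => l; rewrite mxE.
Qed.

(* Every factor of the two bounds is at most a small power of [E = 2 ^ Z]. *)
Section Constants.
Local Open Scope nat_scope.
Variables (d D L : nat).
Hypotheses (d_gt0 : 0 < d) (D_gt0 : 0 < D).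
Let X := (d * D) ^ d.
Let Y := (d * (2 * X)) ^ d.
Let K := L * (X * (2 * Y)).
Let Z := (4 * (d * D)) ^ d.
Let E := 2 ^ Z.
Hypothesis (L_le : L <= 2 ^ (4 * X)).

Let leXZ : 4 ^ d * X = Z. Proof. by rewrite -expnMn. Qed.
Let X_gt0 : 0 < X. Proof. by rewrite expn_gt0 muln_gt0 d_gt0 D_gt0. Qed.
Let le4Z : 4 ^ d <= Z. Proof. by rewrite -leXZ leq_pmulr. Qed.
Let le44 : 4 <= 4 ^ d. Proof. by rewrite -[X in X <= _]expn1 leq_pexp2l. Qed.
Let le_dDX : d * D <= X.
Proof. by rewrite -[X in X <= _]expn1 leq_pexp2l // muln_gt0 d_gt0 D_gt0. Qed.

Let le_dd : d * d <= 4 ^ d.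
Proof. by rewrite -[4]/(2 * 2) expnMn leq_mul // ltnW // ltn_expl. Qed.

Let le_exp2 a : a <= Z -> 2 ^ a <= E.
Proof. by move=> aZ; rewrite leq_exp2l. Qed.

(** The exponent of [d * D] in [X ^ d] is [d * d]; the factor [4 ^ d] in [Z] absorbs it. *)
Let leXd : X ^ d <= E.
Proof.
apply: leq_trans (le_exp2 (eq_leq leXZ)).
rewrite /X -expnM; apply: (@leq_trans ((2 ^ (d * D)) ^ (d * d))).
  by rewrite leq_exp2r ?muln_gt0 ?d_gt0 // ltnW // ltn_expl.
by rewrite -expnM leq_exp2l // mulnC leq_mul.
Qed.

Let leX : X <= E.
Proof. by apply: leq_trans leXd; rewrite -[X in X <= _]expn1 leq_pexp2l. Qed.

Let le2 : 2 <= E.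
Proof. by rewrite -[X in X <= _]expn1 le_exp2 // (leq_trans _ le4Z) // (leq_trans _ le44). Qed.

Let E_gt0 : 0 < E. Proof. exact: ltnW. Qed.

Let leY : Y <= E ^ 3.
Proof.
rewrite /Y 2!expnMn -[E ^ 3]/(E * (E * E)) !leq_mul //.
  by apply: leq_trans leX; rewrite leq_exp2r // leq_pmulr.
by rewrite le_exp2 // (leq_trans _ le4Z) // (leq_trans _ le_dd) // leq_pmulr.
Qed.

Let leK : K <= E ^ 6.
Proof.
rewrite /K -[E ^ 6]/(E * (E * (E * E ^ 3))) !leq_mul //.
by rewrite (leq_trans L_le) // le_exp2 // -leXZ leq_mul.
Qed.

Let leE18 k : k <= 18 -> E ^ k <= 2 ^ ((72 * d * D) ^ d).
Proof.
move=> k18; rewrite -expnM leq_exp2l // mulnC.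
(* The constant is 18 times 4: the 4 comes from [Z], and [18 <= 18 ^ d] moves the outer exponent
   inside the power. *)
have -> : 72 * d * D = 18 * (4 * (d * D)) by rewrite !mulnA.
rewrite [leqRHS]expnMn leq_mul // (leq_trans k18) //.
by rewrite -[X in X <= _]expn1 leq_pexp2l.
Qed.

(** This controls the norm of the common sum [L r], where [r] has norm at most [2 * Y]. *)
Lemma sum_bound : L * (2 * Y) <= 2 ^ ((72 * d * D) ^ d).
Proof.
apply: leq_trans (leE18 (isT : 6 <= 18)); apply: leq_trans leK.
by rewrite leq_mul // leq_pmull.
Qed.

(** The left side is the threshold of [cone_intersection] with the factor [eps] taken out of its
    error. *)
Lemma threshold_bound :
  (4 * X).+1 ^ d * Y * (d * (2 * X) * (D.*2.+1 ^ d * (K * D)).+1)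
    <= 2 ^ ((72 * d * D) ^ d).
Proof.
apply: leq_trans (leE18 (isT : 17 <= 18)).
have -> : E ^ 17 = E ^ 2 * E ^ 3 * (E * (E * E) * (E ^ 8 * E)) by ring.
rewrite !leq_mul //.
- apply: (@leq_trans ((8 * X) ^ d)).
    by rewrite leq_exp2r // -[8]/(4 + 4) mulnDl -addn1 leq_add // muln_gt0.
  rewrite expnMn -[E ^ 2]/(E * E) leq_mul // -[8]/(2 ^ 3) -expnM le_exp2 //.
  apply: leq_trans le4Z; rewrite -[4]/(2 * 2) expnMn.
  have := ltn_expl d (isT : 1 < 2); move: (2 ^ d) => a; nia.
- by rewrite (leq_trans _ leX) // (leq_trans _ le_dDX) // leq_pmulr.
(* The successor costs one more factor [E], which is at least 2. *)
apply: (@leq_trans (E ^ 8).+1); last first.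
  have : 0 < E ^ 8 by rewrite expn_gt0 E_gt0.
  by move: (E ^ 8) => a a0; nia.
rewrite ltnS -[E ^ 8]/(E * (E * E ^ 6)) leq_mul //.
  rewrite (leq_trans _ (ltnW (ltn_expl Z _))) // leq_exp2r //.
  by rewrite -addnn; nia.
rewrite [K * D]mulnC leq_mul ?leK //.
by rewrite (leq_trans _ leX) // (leq_trans _ le_dDX) // leq_pmull.
Qed.

End Constants.

(** * The maximum norm and sums over multisets *)

Lemma ler_mx_norm_int (d : nat) (v : 'rV[int]_d) (c : nat) :
  `|v| <= c%:Z <-> forall j, `|v 0 j| <= c%:Z.
Proof.
rewrite -[(`|v|)]/(mx_norm v) mx_normrE; split=> [vc j|vc].
  by apply: le_trans vc; apply/bigmax_geP; right; exists (0, j).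
by apply/bigmax_leP; split=> // -[i j] _ /=; rewrite [i]ord1.
Qed.

Lemma mx_norm_attained (d : nat) (v : 'rV[int]_d) :
  0 < `|v| -> exists j, `|v| = `|v 0 j|.
Proof.
move=> v0; have [|[i j] /= vE] := @mx_norm_neq0 _ _ _ v; first by rewrite gt_eqF.
by exists j; move: vE; rewrite [i]ord1.
Qed.

Lemma sumr_mset (V : zmodType) (T : {mset V}%mset) :
  \sum_(v <- T) v = \sum_(v <- finsupp T) v *+ T v.
Proof. by rewrite big_mset; apply: eq_bigr => v _; rewrite Monoid.iteropE iter_addr_0. Qed.

Lemma mset_with_multiplicities (V : zmodType) (U : {fset V}) (m : V -> nat) :
  exists S : {mset V}%mset,
    (forall v, S v = if v \in U then m v else 0%N) /\
    \sum_(v <- S) v = \sum_(v <- U) v *+ m v.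
Proof.
pose S : {mset V}%mset := [fsfun v in U => m v].
have SE v : S v = if v \in U then m v else 0%N by rewrite fsfunE.
exists S; split=> //; rewrite sumr_mset.
rewrite (@big_fset_incl _ _ _ _ _ U).
- by apply: eq_big_seq => v vU; rewrite SE vU.
- by apply/fsubsetP => v; rewrite mem_finsupp SE; case: ifP.
by move=> v _; rewrite memNfinsupp => /eqP->.
Qed.

(** The discarded vectors are distinct points of the box, each of multiplicity below [K]. *)
Lemma high_multiplicity_part (d D K : nat) (T : {mset 'rV[int]_d}%mset) :
  (forall v, v \in T -> forall l, `|v 0 l| <= D%:Z) ->
  forall l, `|(\sum_(v <- T) v
               - \sum_(v <- [fset v in finsupp T | (K <= T v)%N]%fset) v *+ T v) 0 l|
    <= (D.*2.+1 ^ d * (K * D))%N%:Z.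
Proof.
move=> TD l; set U := [fset v in _ | _]%fset.
rewrite sumr_mset (big_fsetID _ (fun v => K <= T v)%N) /= -/U addrAC subrr add0r.
set W := [fset v in _ | _]%fset.
rewrite summxE (le_trans (ler_norm_sum _ _ _)) //.
have WD v : v \in W -> forall l, `|v 0 l| <= D%:Z.
  by rewrite !inE /= => /andP[vT _]; apply: TD; rewrite -msuppE.
apply: (@le_trans _ _ (\sum_(v <- W) (K * D)%N%:Z)).
  rewrite big_seq [leRHS]big_seq; apply: ler_sum => v vW.
  have TvK : (T v <= K)%N by move: vW; rewrite !inE /= -ltnNge => /andP[_ /ltnW].
  rewrite -scaler_nat mxE normrM natz ger0_norm // PoszM ler_pM //.
  exact: WD.
rewrite big_const_seq count_predT iter_addr_0 -mulr_natl natz -PoszM lez_nat.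
rewrite leq_mul // -size_box uniq_leq_size // => v /WD vD.
by rewrite mem_box; apply/forallP.
Qed.

(** * Construction of the submultisets *)

Lemma common_submultisets (d Delta n eps : nat) (T : 'I_n -> {mset 'rV[int]_d}%mset)
    (b : 'rV[int]_d) (F := (2 ^ ((72 * d * Delta) ^ d))%N) :
  (0 < d)%N -> (0 < Delta)%N -> (0 < eps)%N ->
  (forall i v, v \in T i -> `|v| <= Delta%:Z) ->
  (forall i, `|\sum_(v <- T i) v - b| < eps%:Z) ->
  (eps * F)%N%:Z < `|b| ->
  exists (S : 'I_n -> {mset 'rV[int]_d}%mset) (b' : 'rV[int]_d),
    [/\ (forall i, S i <> mset0), (forall i, (S i `<=` T i)%mset),
        `|b'| <= F%:Z & forall i, \sum_(v <- S i) v = b'].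
Proof.
move=> d0 D0 eps0 TD Tb bF.
pose X := ((d * Delta) ^ d)%N; pose Y := ((d * (2 * X)) ^ d)%N.
have X0 : (0 < X)%N by rewrite expn_gt0 muln_gt0 d0 D0.
have [L /andP[L0 L_le] LP] := small_common_multiple X0.
(* An upper bound for the coefficients [L %/ q * c v] used below, so vectors of multiplicity at
   least [K] suffice. *)
pose K := (L * (X * (2 * Y)))%N.
have {}TD i v : v \in T i -> forall l, `|v 0 l| <= Delta%:Z.
  by move=> /TD/ler_mx_norm_int.
pose U i := [fset v in finsupp (T i) | (K <= T i v)%N]%fset.
pose M := (Delta.*2.+1 ^ d * (K * Delta))%N.
have UD i v : v \in (U i : seq _) -> forall l, `|v 0 l| <= Delta%:Z.
  rewrite -[v \in _]/(v \in U i) !inE /= => /andP[vT _].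
  by apply: (TD i); rewrite -msuppE.
(* The error is [eps] from the hypothesis plus [M] from the discarded vectors; bounding it by a
   multiple of [eps] keeps the threshold linear in [eps]. *)
have Ub i l : `|(b - \sum_(v <- U i) v *+ T i v) 0 l| <= (eps * M.+1)%N%:Z.
  rewrite -(subrKA (\sum_(v <- T i) v)) mxE (le_trans (ler_normD _ _)) //.
  apply: (@le_trans _ _ (eps%:Z + M%:Z)).
    rewrite lerD ?high_multiplicity_part //; last exact: TD.
    have /ltW/ler_mx_norm_int/(_ l) Tbl := Tb i.
    by rewrite -opprB mxE normrN.
  by rewrite -PoszD lez_nat mulnS leq_add2l leq_pmull.
have [j bj] : exists j, `|b| = `|b 0 j|.
  by apply: mx_norm_attained; apply: le_lt_trans bF; rewrite lez_nat.
have bj_lt : ((4 * X).+1 ^ d * Y * (d * (2 * X) * (eps * M.+1)))%N%:Z < `|b 0 j|.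
  rewrite -bj; apply: le_lt_trans bF; rewrite lez_nat.
  have -> : ((4 * X).+1 ^ d * Y * (d * (2 * X) * (eps * M.+1)) =
    eps * ((4 * X).+1 ^ d * Y * (d * (2 * X) * M.+1)))%N by ring.
  by rewrite leq_mul2l threshold_bound // orbT.
have [r [nz_r rY rU]] :=
  cone_intersection d0 D0 (fun i => fset_uniq (U i)) UD Ub bj_lt.
have S_ex i : exists S : {mset 'rV[int]_d}%mset,
    [/\ S <> mset0, (S `<=` T i)%mset & \sum_(v <- S) v = r *+ L].
  have [q [c [qX cX rq]]] := rU i.
  (* [q] depends on [i], but it divides [L]; scaling by [L %/ q] gives every [i] the same sum
     [r *+ L], which is nonzero. *)
  have [S [SE sumS]] := mset_with_multiplicities (U i) (fun v => (L %/ q * c v)%N).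
  have sumSE : \sum_(v <- S) v = r *+ L.
    rewrite sumS -{2}(divnK (LP q qX)) mulnC mulrnA rq -sumrMnl.
    by apply: eq_bigr => v _; rewrite -mulrnA mulnC.
  exists S; split=> //.
    move=> S0; move: sumSE; rewrite S0 big_mset0 => /esym/eqP.
    by rewrite -scaler_nat scalemx_eq0 (negPf nz_r) orbF natz gt_eqF.
  apply/msubsetP => v; rewrite SE; case: ifP => // vU.
  have : (K <= T i v)%N by move: vU; rewrite !inE /= => /andP[].
  by apply: leq_trans; rewrite leq_mul // leq_div.
have [S SP] := choice S_ex.
exists S, (r *+ L); split; try by move=> i; case: (SP i).
apply/ler_mx_norm_int => l.
rewrite -scaler_nat mxE normrM natz ger0_norm //.
apply: (@le_trans _ _ (L%:Z * (2 * Y)%N%:Z)); first by rewrite ler_wpM2l.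
by rewrite -PoszM lez_nat sum_bound.
Qed.

Unset Implicit Arguments.

Theorem theorem4p1 (R : realType) :
  exists (C : R) (f : nat -> nat -> R),
    [/\ 0 < C,
        (forall d Delta : nat, (0 < d)%N -> (0 < Delta)%N ->
           f d Delta <= 2 `^ ((C * d%:R * Delta%:R) ^+ d))
      & forall (d Delta n : nat) (T : 'I_n -> {mset 'rV[int]_d}%mset)
          (b : 'rV[int]_d) (eps : nat),
          (0 < d)%N -> (0 < Delta)%N -> (0 < n)%N -> (0 < eps)%N ->
          (forall (i : 'I_n) (v : 'rV[int]_d), v \in T i -> `|v| <= Delta%:Z) ->
          (forall i : 'I_n, `|\sum_(v <- T i) v - b| < eps%:Z) ->
          eps%:R * f d Delta < (`|b|)%:~R ->
          exists (S : 'I_n -> {mset 'rV[int]_d}%mset) (b' : 'rV[int]_d),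
            [/\ (forall i : 'I_n, S i <> mset0),
                (forall i : 'I_n, (S i `<=` T i)%mset),
                (`|b'|)%:~R <= f d Delta
              & forall i : 'I_n, \sum_(v <- S i) v = b'] ].
Proof.
(* [f] is the cast of a natural number, so both comparisons with norms reduce to integers. *)
exists 72%:R, (fun d Delta => (2 ^ ((72 * d * Delta) ^ d))%N%:R); split.
- by rewrite ltr0n.
- by move=> d Delta _ _; rewrite -!natrM -natrX powR_mulrn ?natrX.
move=> d Delta n T b eps d0 D0 _ eps0 TD Tb.
rewrite -natrM -[_%:R]/(_%:Z%:~R) ltr_int => bF.
have [S [b' [S0 ST b'F Sb']]] := common_submultisets d0 D0 eps0 TD Tb bF.
by exists S, b'; split=> //; rewrite -[X in _ <= X]/(_%:Z%:~R) ler_int.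
Qed.
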